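(* Let $C$ be a non-empty compact convex subset of $\mathbb{R}^d$, $d\in\mathbb{N}$. Suppose that $\mathcal{H}$ is a set of supporting affine functionals at points of $C$ such that $$C=\{t\in\mathbb{R}^d : h(t)\ge 0 \text{ for all } h\in\mathcal{H}\}.$$ Let $\mathcal{S}(\mathcal{H})$ denote the semiring of $\mathbb{R}[x_1,\dots,x_d]$ generated by $\mathcal{H}$. Then $\mathcal{S}(\mathcal{H})$ is Archimedean. If $f\in\mathbb{R}[x_1,\dots,x_d]$ satisfies $f(t)>0$ for all $t\in C$, then $f\in\mathcal{S}(\mathcal{H})$.
   Context: Let $\mathcal{A}_d$ be the vector space of polynomials in $\mathbb{R}[x_1,\dots,x_d]$ of degree at most one. A supporting affine functional at a point $t_0\in C$ is a polynomial $h\in\mathcal{A}_d$, $h\ne 0$, with $h(t_0)=0$ and $h(t)\ge 0$ for all $t\in C$. A semiring of a commutative unital $\mathbb{R}$-algebra $\mathcal{A}$ is a subset $\mathcal{S}$ containing $1$ that is closed under addition, under multiplication by real scalars $\lambda\ge0$, and under multiplication; the semiring generated by a set is the smallest semiring containing it. $\mathcal{S}$ is Archimedean if for every $a\in\mathcal{A}$ there is $\lambda\in(0,\infty)$ with $\lambda 1-a\in\mathcal{S}$ and $\lambda 1+a\in\mathcal{S}$. *)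

(* Defs.v *)
From HB Require Import structures.
From mathcomp Require Import all_boot all_order all_algebra.
From mathcomp Require Import boolp classical_sets reals topology convex.
From mathcomp Require Import normedtype.
(* The notations of [mpoly] have precedence levels incompatible with those of
   MathComp-Analysis. *)
From mathcomp Require Import -(notations) mpoly.

Set Implicit Arguments.
Unset Strict Implicit.
Unset Printing Implicit Defensive.

Import Order.TTheory GRing.Theory Num.Theory.
Import numFieldNormedType.Exports.

Local Open Scope classical_set_scope.
Local Open Scope ring_scope.

Notation "{ 'mpoly' R [ d ] }" := (mpoly d R)
  (at level 0, R at level 2, d at level 2, format "{ 'mpoly'  R [ d ] }")
  : type_scope.

Definition mpoly_at (R : realType) (d : nat) (p : {mpoly R[d]})
    (t : 'rV[R]_d) : R :=
  meval (fun i : 'I_d => t ord0 i) p.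

(* [mmeasure mdeg p] (that is, [msize p]) is one more than the degree of [p], and
   [0] if [p = 0]. *)
Definition affine_functionals (R : realType) (d : nat) : set {mpoly R[d]} :=
  [set h | (mmeasure mdeg h <= 2)%N].

Definition supporting_at (R : realType) (d : nat) (C : set 'rV[R]_d)
    (t0 : 'rV[R]_d) (h : {mpoly R[d]}) : Prop :=
  [/\ affine_functionals h, h <> 0, mpoly_at h t0 = 0
    & forall t, C t -> 0 <= mpoly_at h t].

Definition is_semiring (R : realType) (A : comAlgType R) (S : set A) : Prop :=
  [/\ S 1,
      forall a b, S a -> S b -> S (a + b),
      forall (l : R) a, 0 <= l -> S a -> S (l *: a)
    & forall a b, S a -> S b -> S (a * b)].

Definition semiring_gen (R : realType) (A : comAlgType R) (G : set A) : set A :=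
  smallest (@is_semiring R A) G.

Definition archimedean (R : realType) (A : comAlgType R) (S : set A) : Prop :=
  forall a : A, exists2 l : R, 0 < l & S (l *: 1 - a) /\ S (l *: 1 + a).

(* Main.v *)
Require Import Defs.
From HB Require Import structures.
From mathcomp Require Import all_boot all_order all_algebra.
From mathcomp Require Import ring lra.
From mathcomp Require Import boolp classical_sets reals topology convex.
From mathcomp Require Import normedtype.
From mathcomp Require Import -(notations) mpoly.

(** Both halves of the theorem come from one construction. Start from a convex
    cone in an algebra that does not contain -1 and enlarge it, by Zorn's lemma,
    to a maximal such cone [M]. Then [M] is total: it contains [a] or [- a] for
    every [a], so [0 <= a] may be read as [M a]. If [e] is in [M] but
    [- e] is not, and [e] dominates [a], meaning that [l e - a] and [l e + a] lie
    in [M] for some [l > 0], then by completeness of the reals there is a unique real [r], the standard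
    part of [a] relative to [e], such that [a - r e] is smaller than every
    positive multiple of [e]. Standard parts are linear in [a] and nonnegative
    on [M].

    The semiring generated by [H] is Archimedean. The elements bounded by
    multiples of 1 form a subalgebra, so it is enough to bound the coordinates.
    Let [b] be [x_i] or [- x_i] and suppose that [l - b] is never in the
    semiring [S]. Then -1 is not in the cone generated by [S] and all the
    [b - l]; in a total cone [M] that contains it, [b] is infinitely large
    relative to 1. Let [e] be the largest among 1 and the coordinates up to
    sign. It is not 1, so it is a coordinate up to sign, and 1 is infinitesimal
    relative to [e]. The standard part relative to [e] is then a linear
    functional on affine polynomials that vanishes at 1, is nonnegative on [H],
    and is nonzero at some coordinate: it is a direction along which every
    [h] in [H] is nondecreasing ([recession_direction]). Since [C] is non-empty,
    it would be unbounded ([archimedean_semiring_gen]).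

    A positive [f] lies in [S]. This is the Kadison-Dubois argument
    ([archimedean_positivstellensatz]). If no [s] and [s'] in [S] satisfy
    [s f = 1 + s'], then -1 is not in the [S]-module [S - S f]. In a maximal
    [S]-module [M] that contains it, 1 dominates everything because [S] is
    Archimedean, and the standard part relative to 1 is now multiplicative
    because [M] absorbs [S]. So it is evaluation at a point [t], which lies in
    [C] since [M] contains [H]; but [- f] is in [M], so [f] is at most 0 at [t].
    Hence [s f = 1 + s'] for some [s] and [s'] in [S], and
    [archimedean_descent] turns this equality into membership of [f]. *)

Set Implicit Arguments.
Unset Strict Implicit.
Unset Printing Implicit Defensive.

Import Order.TTheory GRing.Theory Num.Theory.
Import numFieldNormedType.Exports.

Local Open Scope classical_set_scope.
Local Open Scope ring_scope.

(** * Maximal cones and modules *)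

(** Scaling becomes multiplication by the image of a ring morphism, which lets
    [ring] normalize linear combinations. *)
Lemma scale_in_alg (R : realType) (A : comAlgType R) (c : R) (a : A) :
  c *: a = in_alg A c * a.
Proof. by rewrite in_algE mulr_algl. Qed.

Ltac alg_ring := rewrite ?scale_in_alg; ring.

Section Modules.
Variables (R : realType) (A : comAlgType R).
Implicit Types (S M N : set A) (a b e x : A) (l r c : R).

(** The choice of [S] separates the two uses: over [scalars] these are convex
    cones containing 1, over a semiring they are modules that absorb it. *)
Definition module_over S M : Prop :=
  [/\ M 1, forall a b, M a -> M b -> M (a + b)
    & forall s a, S s -> M a -> M (s * a)].

Definition total M : Prop := forall a, M a \/ M (- a).

(** [archimedean S] says that 1 dominates every element with respect to [S]. *)
Definition dominated M e a : Prop :=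
  exists2 l : R, 0 < l & M (l *: e - a) /\ M (l *: e + a).

Definition infinitesimal M e a : Prop :=
  forall c : R, 0 < c -> M (c *: e - a) /\ M (c *: e + a).

Definition scalars : set A := [set l *: 1 | l in [set l : R | 0 <= l]].

Lemma scalars_semiring : is_semiring scalars.
Proof.
split; first by exists 1; rewrite /= ?ler01 ?scale1r.
- by move=> _ _ [l l0 <-] [r r0 <-]; exists (l + r); rewrite /= ?addr_ge0 ?scalerDl.
- by move=> c _ c0 [l l0 <-]; exists (c * l); rewrite /= ?mulr_ge0 ?scalerA.
- move=> _ _ [l l0 <-] [r r0 <-]; exists (l * r); rewrite /= ?mulr_ge0 //.
  by rewrite -scalerAl mul1r scalerA.
Qed.

Lemma semiring_scalar S l : is_semiring S -> 0 <= l -> S (l *: 1).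
Proof. by case=> S1 _ SZ _ l0; exact: SZ. Qed.

Lemma moduleZ S M l a :
  is_semiring S -> module_over S M -> 0 <= l -> M a -> M (l *: a).
Proof.
move=> HS [_ _ MS] l0 Ma; rewrite -[a]mul1r scalerAl.
by apply: MS => //; exact: semiring_scalar.
Qed.

Lemma dominated_subset S M e a : S `<=` M -> dominated S e a -> dominated M e a.
Proof. by move=> SM [l l0 [/SM ? /SM ?]]; exists l. Qed.

(** Zorn's lemma. If [a] is not in the maximal [M], then [M + S a] is a larger
    module over [S], so it contains -1. *)
Lemma maximal_module S N : is_semiring S -> module_over S N -> ~ N (- 1) ->
  exists M, [/\ module_over S M, N `<=` M, ~ M (- 1)
    & forall a, M a \/ exists m s, [/\ M m, S s & m + s * a = - 1]].
Proof.
move=> HS HN N1.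
(* Joining [N] to the sets of a chain makes the empty chain harmless. *)
pose P X := module_over S (N `|` X) /\ ~ (N `|` X) (- 1).
have [F FP Ftot|X [[HM M1] Xmax]] := @Zorn_bigcup A P.
  split; last first.
    by case=> // -[X FX X1]; have [_] := FP _ FX; apply; right.
  split; first by left; case: HN.
    have join X Y a b : F X -> F Y -> (N `|` X) a -> (N `|` Y) b ->
        (N `|` \bigcup_(X in F) X) (a + b).
      move=> FX FY Xa Yb.
      wlog XY : X Y a b FX FY Xa Yb / X `<=` Y.
        move=> W; have [XY|YX] := Ftot _ _ FX FY; first exact: (W X Y).
        by rewrite addrC; exact: (W Y X).
      have [[_ YD _] _] := FP _ FY.
      have Ya : (N `|` Y) a by case: Xa => [?|/XY ?]; [left|right].
      by have [?|?] := YD a b Ya Yb; [left|right; exists Y].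
    move=> a b [Na|[X FX Xa]] [Nb|[Y FY Yb]].
    + by left; case: HN => _ ND _; exact: ND.
    + by apply: (join Y Y) => //; [left|right].
    + by apply: (join X X) => //; [right|left].
    + by apply: (join X Y) => //; right.
  move=> s a Ss [Na|[X FX Xa]]; first by left; case: HN => _ _; apply.
  have [[_ _ XS] _] := FP _ FX.
  have Na : (N `|` X) a by right.
  by have [?|?] := XS s a Ss Na; [left|right; exists X].
exists (N `|` X); split => //.
move=> a; apply: contrapT => /not_orP[Ma maxa].
have [S1 SD SZ SM] := HS; have [N1' MD MS] := HM.
have M0 : (N `|` X) 0 by rewrite -(scale0r 1); apply: (moduleZ HS HM).
have S0 : S 0 by rewrite -(scale0r 1); exact: semiring_scalar.
pose Y := [set m + s * a | m in N `|` X & s in S] : set A.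
have sub : N `|` X `<=` Y.
  by move=> m Mm; exists m => //; exists 0; rewrite // mul0r addr0.
have NY : N `|` Y = Y.
  by apply/seteqP; split=> y; [case=> // Ny; apply: sub; left|right].
apply: (Xmax Y).
  split; first by move=> x Xx; apply: sub; right.
  move=> YX; apply: Ma; right; apply: YX; exists 0 => //; exists 1 => //.
  by rewrite mul1r add0r.
rewrite /P NY; split.
  split; first exact: sub.
  - move=> _ _ [m Mm [s Ss <-]] [m' Mm' [s' Ss' <-]].
    exists (m + m'); first exact: MD.
    by exists (s + s'); [exact: SD | alg_ring].
  - move=> t _ St [m Mm [s Ss <-]].
    exists (t * m); first exact: MS.
    by exists (t * s); [exact: SM | alg_ring].
by case=> m Mm [s Ss E]; apply: maxa; exists m, s.
Qed.

(** If neither [a] nor [- a] is in [M], write [-1 = m + s a] and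
    [-1 = m' - s' a]. Eliminating [a] shows that [- s] is in [M]; if that forces
    [s a] into [M], then -1 is in [M] as well. The condition on [S] holds for
    the nonnegative scalars, where [s = 0], and for Archimedean semirings. *)
Lemma maximal_total S M : is_semiring S -> module_over S M -> S `<=` M ->
  ~ M (- 1) ->
  (forall a, M a \/ exists m s, [/\ M m, S s & m + s * a = - 1]) ->
  (forall s a, S s -> M (- s) -> M (s * a)) -> total M.
Proof.
move=> HS [_ MD MS] SM M1 Mmax Mideal a.
have [|[m [s [Mm Ss E]]]] := Mmax a; first by left.
have [|[m' [s' [Mm' Ss' E']]]] := Mmax (- a); first by right.
exfalso; apply: M1; rewrite -E; apply: (MD) => //.
apply: Mideal => //.
(* Multiply the first equation by [s'], the second by [s], and add. *)
have -> : - s = s' + s' * m + s * m'.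
  have -> : m = - 1 - s * a by rewrite -E; alg_ring.
  have -> : m' = - 1 + s' * a by rewrite -E'; alg_ring.
  alg_ring.
by apply: (MD); [apply: (MD); [exact: SM | exact: MS] | exact: MS].
Qed.

(** * Standard parts *)

Section StandardPart.
Variables (S M : set A).
Hypotheses (HS : is_semiring S) (HM : module_over S M).

Let MD a b : M a -> M b -> M (a + b). Proof. by case: HM => _ + _; apply. Qed.
Let MZ l a : 0 <= l -> M a -> M (l *: a). Proof. exact: (moduleZ HS HM). Qed.

Lemma dominatedN e a : dominated M e a -> dominated M e (- a).
Proof. by move=> [l l0 [? ?]]; exists l; rewrite ?opprK. Qed.

Lemma infinitesimalN e a : infinitesimal M e a -> infinitesimal M e (- a).
Proof. by move=> I c /I[? ?]; rewrite opprK. Qed.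

Lemma infinitesimalD e a b :
  infinitesimal M e a -> infinitesimal M e b -> infinitesimal M e (a + b).
Proof.
move=> Ia Ib c c0; have c20 : 0 < c / 2 by lra.
have [? ?] := Ia _ c20; have [? ?] := Ib _ c20.
have -> : c *: e = (c / 2) *: e + (c / 2) *: e by rewrite -scalerDl -splitr.
split.
- rewrite opprD addrACA; exact: MD.
- rewrite addrACA; exact: MD.
Qed.

Lemma infinitesimalZ e a r : M e ->
  infinitesimal M e a -> infinitesimal M e (r *: a).
Proof.
move=> Me Ia.
wlog r0 : r / 0 <= r.
  move=> W; have [/W//|r0] := lerP 0 r.
  rewrite -[r *: a]opprK -scaleNr; apply: infinitesimalN; apply: W; lra.
move=> c c0; set d := c / (r + 1).
have d0 : 0 < d by apply: divr_gt0 => //; lra.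
have [? ?] := Ia _ d0.
have -> : c = r * d + d by rewrite /d; field; apply/eqP; lra.
split.
- have -> : (r * d + d) *: e - r *: a = r *: (d *: e - a) + d *: e by alg_ring.
  by apply: MD; apply: MZ => //; exact: ltW.
- have -> : (r * d + d) *: e + r *: a = r *: (d *: e + a) + d *: e by alg_ring.
  by apply: MD; apply: MZ => //; exact: ltW.
Qed.

Lemma module_neg_scale e r : ~ M (- e) -> r < 0 -> ~ M (r *: e).
Proof.
move=> Ne r0 Mr; apply: Ne.
have -> : - e = (- r^-1) *: (r *: e).
  by rewrite scalerA mulNr mulVf ?scaleN1r // ltr0_neq0.
by apply: MZ => //; rewrite oppr_ge0 invr_le0 ltW.
Qed.

(** The standard part is the cut that the total preorder makes on the line of
    multiples of [e], that is, the supremum of the [r] with [a - r e] in [M]. *)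
Lemma standard_part_exists e a : total M -> M e -> ~ M (- e) ->
  dominated M e a -> exists r, infinitesimal M e (a - r *: e).
Proof.
move=> Mtot Me Ne [l l0 [lo up]].
pose E := [set r : R | M (a - r *: e)].
have ubE : ubound E l.
  move=> r Er; rewrite leNgt; apply/negP => lr.
  apply: (module_neg_scale Ne (r := l - r)); first by lra.
  have -> : (l - r) *: e = (l *: e - a) + (a - r *: e) by alg_ring.
  exact: MD.
have supE : has_sup E.
  by split; [exists (- l); rewrite /E /= scaleNr opprK addrC | exists l].
exists (sup E) => c c0; split.
- have [|Mc] := Mtot (c *: e - (a - sup E *: e)); first by [].
  have /(sup_upper_bound supE) : E (sup E + c).
    by rewrite /E /=; move: Mc; congr (M _); alg_ring.
  lra.
- have [r Er sr] := sup_adherent c0 supE.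
  have -> : c *: e + (a - sup E *: e) = (a - r *: e) + (c + r - sup E) *: e.
    alg_ring.
  by apply: MD => //; apply: MZ => //; lra.
Qed.

Lemma standard_part_ge0 e a r : ~ M (- e) ->
  infinitesimal M e (a - r *: e) -> M a -> 0 <= r.
Proof.
move=> Ne I Ma; rewrite leNgt; apply/negP => r0.
have [] := I (- r / 2); first by lra.
move=> /MD/(_ Ma) + _.
have -> : (- r / 2) *: e - (a - r *: e) + a = (r / 2) *: e.
  by rewrite [in RHS](_ : r / 2 = - r / 2 + r); [alg_ring | lra].
by apply: module_neg_scale => //; lra.
Qed.

Lemma infinitesimal_unit e r : ~ M (- e) -> infinitesimal M e (r *: e) -> r = 0.
Proof.
move=> Ne I; apply/eqP; rewrite eq_le; apply/andP; split.
- rewrite leNgt; apply/negP => r0; have [] := I (r / 2); first by lra.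
  by move=> + _; rewrite -scalerBl; apply: module_neg_scale => //; lra.
- rewrite leNgt; apply/negP => r0; have [] := I (- r / 2); first by lra.
  by move=> _; rewrite -scalerDl; apply: module_neg_scale => //; lra.
Qed.

(** This makes the standard part relative to 1 multiplicative. For [s] in [S]
    with [k - s] in [S], the product [s a] is at most [k] times a bound of [a];
    a general [b] is such an [s] minus a constant. *)
Lemma infinitesimalM a b : S `<=` M -> archimedean S ->
  infinitesimal M 1 a -> infinitesimal M 1 (b * a).
Proof.
move=> SM Sarch Ia.
have [l l0 [_ Slb]] := Sarch b; set s := l *: 1 + b in Slb.
have [k k0 [Sks _]] := Sarch s.
have [M1 _ MS] := HM.
have -> : b * a = s * a + (- l) *: a.
  by rewrite /s mulrDl -scalerAl mul1r scaleNr; alg_ring.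
apply: infinitesimalD; last exact: infinitesimalZ.
move=> c c0; set d := c / k; have d0 : 0 < d by exact: divr_gt0.
have [? ?] := Ia _ d0.
have Mks : M (d *: (k *: 1 - s)) by apply: MZ; [exact: ltW | exact: SM].
have -> : c = d * k by rewrite /d divfK // lt0r_neq0.
split.
- have -> : (d * k) *: 1 - s * a = d *: (k *: 1 - s) + s * (d *: 1 - a) :> A.
    alg_ring.
  by apply: MD => //; exact: MS.
- have -> : (d * k) *: 1 + s * a = d *: (k *: 1 - s) + s * (d *: 1 + a) :> A.
    alg_ring.
  by apply: MD => //; exact: MS.
Qed.

(** A maximum, up to sign, of 1 and finitely many elements for the total
    preorder; dominating means that multiples are ignored. *)
Lemma exists_dominating (xs : seq A) : total M -> exists e,
  [/\ M e, e = 1 \/ (exists2 x, x \in xs & e = x \/ e = - x),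
      dominated M e 1 & forall x, x \in xs -> dominated M e x].
Proof.
move=> Mtot; have M1 : M 1 by case: HM.
have M0 : M 0 by rewrite -(scale0r 1); exact: MZ.
have self e : M e -> dominated M e e.
  by move=> Me; exists 1; rewrite ?scale1r ?subrr //; split=> //; exact: MD.
elim: xs => [|x xs [e [Me e1 dom1 dom]]].
  by exists 1; split => //; [left | exact: self].
have [y [My yx dx]] : exists y, [/\ M y, y = x \/ y = - x
    & forall e, dominated M e y -> dominated M e x].
  have [Mx|Mx] := Mtot x; first by exists x; split => //; left.
  by exists (- x); split => //; [right|move=> ? /dominatedN; rewrite opprK].
have [Mey|Mye] := Mtot (e - y).
  exists e; split => //.
    by case: e1 => [|[z zxs ze]]; [left|right; exists z; rewrite // inE zxs orbT].
  move=> z; rewrite inE => /orP[/eqP ->|/dom//]; apply: dx.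
  by exists 1; rewrite ?scale1r //; split => //; exact: MD.
have trans a : dominated M e a -> dominated M y a.
  move=> [l l0 [? ?]]; exists l => //.
  have Mly : M (l *: (- (e - y))) by apply: MZ => //; exact: ltW.
  split.
  - have -> : l *: y - a = l *: (- (e - y)) + (l *: e - a) by alg_ring.
    exact: MD.
  - have -> : l *: y + a = l *: (- (e - y)) + (l *: e + a) by alg_ring.
    exact: MD.
exists y; split => //.
- by right; exists x; rewrite // inE eqxx.
- exact: trans.
- move=> z; rewrite inE => /orP[/eqP ->|/dom]; last exact: trans.
  by apply: dx; exact: self.
Qed.

End StandardPart.

(** A form of the supporting hyperplane theorem for the cone [S]: the standard
    part relative to [e] is defined on the span of [xs], nonnegative on [S], and
    vanishes at 1, which is not an interior point of [S] because no [l - b] is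
    in [S]. *)
Lemma supporting_functional S b (xs : seq A) : is_semiring S -> ~ S (- 1) ->
  (forall l, ~ S (l *: 1 - b)) -> (exists2 x, x \in xs & b = x \/ b = - x) ->
  exists M e, [/\ module_over scalars M /\ S `<=` M, M e /\ ~ M (- e),
    infinitesimal M e 1,
    (exists2 x, x \in xs & e = x \/ e = - x)
    & forall x, x \in xs -> exists r, infinitesimal M e (x - r *: e)].
Proof.
move=> HS NS1 Nb [x xxs xb]; have [S1 SD SZ SM] := HS.
have Hsc := scalars_semiring.
(* [N] is the cone generated by [S] and all the [b - l]: the condition
   [r = 0 -> l = 0] says that constants are subtracted only along with [b]. *)
pose N := [set a | exists r l k,
  [/\ 0 <= r, r = 0 -> l = 0, S k & a = k + r *: b - l *: 1]].
have SN : S `<=` N.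
  by move=> k Sk; exists 0, 0, k; split => //; rewrite !scale0r addr0 subr0.
have HN : module_over scalars N.
  split; first exact: SN.
  - move=> _ _ [r [l [k [r0 rl Sk ->]]]] [r' [l' [k' [r'0 rl' Sk' ->]]]].
    exists (r + r'), (l + l'), (k + k'); split; [lra| |exact: SD|alg_ring].
    by move=> rr; rewrite rl ?rl' ?addr0//; lra.
  - move=> _ _ [c c0 <-] [r [l [k [r0 rl Sk ->]]]].
    exists (c * r), (c * l), (c *: k); split; [exact: mulr_ge0| |exact: SZ|].
      by move=> /eqP; rewrite mulf_eq0 => /orP[/eqP ->|/eqP/rl ->];
        rewrite ?mul0r ?mulr0.
    alg_ring.
have N1 : ~ N (- 1).
  move=> [r [l [k [r0 rl Sk E]]]].
  have [rz|rn] := eqVneq r 0.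
    by apply: NS1; rewrite E rz (rl rz) !scale0r addr0 subr0.
  apply: (Nb (r^-1 * (l - 1))).
  have -> : (r^-1 * (l - 1)) *: 1 - b = r^-1 *: k.
    have -> : k = (l - 1) *: 1 - r *: b by rewrite scalerBl scale1r E; alg_ring.
    by rewrite scalerBr !scalerA mulVf // scale1r.
  by apply: (SZ) => //; rewrite invr_ge0.
have [M [HM NM M1 Mmax]] := maximal_module Hsc HN N1.
have MM1 : M 1 by case: HM.
have MD a a' : M a -> M a' -> M (a + a') by case: HM => _ + _; apply.
have MZ l a : 0 <= l -> M a -> M (l *: a) by exact: (moduleZ Hsc HM).
have scM : scalars `<=` M by move=> _ [l l0 <-]; exact: MZ.
have Mtot : total M.
  apply: (maximal_total Hsc) => // _ a [l l0 <-].
  rewrite /= in l0; rewrite -scaleNr; have [l1|l1] := ltP 0 l; last first.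
    have -> : l = 0 by apply/eqP; rewrite eq_le l0 l1.
    by move=> _; rewrite scale0r mul0r -(scale0r 1); exact: MZ.
  move=> Ml; exfalso; apply: (module_neg_scale Hsc HM M1 _ Ml); lra.
have Mb l : M (b - l *: 1).
  apply: NM; exists 1, l, 0; split => //.
  - by move/eqP; rewrite oner_eq0.
  - by rewrite -(scale0r 1); exact: SZ.
  - by rewrite add0r scale1r.
have [e [Me e1 dom1 dom]] := exists_dominating Hsc HM xs Mtot.
have domb : dominated M e b.
  by case: xb => ->; [|apply: dominatedN]; exact: dom.
have ne : ~ M (- e).
  have [l l0 [Ml _]] := dom1; move=> Mne; apply: M1.
  have -> : - 1 = l *: (- e) + (l *: e - 1) by alg_ring.
  by apply: MD => //; apply: MZ => //; exact: ltW.
exists M, e; split => //.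
- by split=> // a /SN /NM.
- have [m m0 [Mm _]] := domb; move=> c c0; split.
    have -> : c *: e - 1 = (c / m) *: ((m *: e - b) + (b - (m / c) *: 1)).
      rewrite addrA subrK scalerBr !scalerA divfK ?lt0r_neq0 //.
      have -> : c / m * (m / c) = 1 by field; rewrite !lt0r_neq0.
      by rewrite scale1r.
    by apply: MZ; [exact/ltW/divr_gt0 | exact: MD].
  by apply: MD => //; apply: MZ => //; exact: ltW.
(* The case [e = 1] would put both [m - b] and [b - (m + 1)] in [M]. *)
- case: e1 => // e1; exfalso; apply: M1.
  have [m m0 [Mm _]] := domb; rewrite e1 in Mm.
  have -> : - 1 = (m *: 1 - b) + (b - (m + 1) *: 1) by alg_ring.
  exact: MD.
- by move=> y /dom; exact: (standard_part_exists Hsc HM).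
Qed.

(** If [k - a] is in [S] and [- s] is in [M], then
    [s a = (k - a) (- s) + k s] is in [M]. *)
Lemma archimedean_module_total S M : is_semiring S -> archimedean S ->
  module_over S M -> S `<=` M -> ~ M (- 1) ->
  (forall a, M a \/ exists m s, [/\ M m, S s & m + s * a = - 1]) -> total M.
Proof.
move=> HS Sarch HM SM M1 Mmax; have [_ MD MS] := HM.
apply: (maximal_total HS) => // s a Ss Mns.
have [k k0 [Sk _]] := Sarch a.
have -> : s * a = (k *: 1 - a) * (- s) + k *: s.
  by rewrite mulrBl -scalerAl mul1r; alg_ring.
apply: MD; first exact: MS.
by apply: (moduleZ HS HM) => //; [exact: ltW | exact: SM].
Qed.

(** If [k - s] is in [S] and [f + r] is in [S] with [0 <= r], then so is
    [f + r - 1 / k], because [k (f + r) - 1 = (k - s) (f + r) + s' + r s].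
    Starting from any [r] with [f + r] in [S], finitely many such steps make
    [r] nonpositive. *)
Lemma archimedean_descent S f s s' : is_semiring S -> archimedean S ->
  S s -> S s' -> s * f = 1 + s' -> S f.
Proof.
move=> HS Sarch Ss Ss' E; have [S1 SD SZ SM] := HS.
have [k k0 [Sks _]] := Sarch s.
have step r : 0 <= r -> S (f + r *: 1) -> S (f + (r - k^-1) *: 1).
  move=> r0 Sr.
  have -> : f + (r - k^-1) *: 1
      = k^-1 *: ((k *: 1 - s) * (f + r *: 1) + s' + r *: s).
    have -> : s' = s * f - 1 by rewrite E; alg_ring.
    have -> : (k *: 1 - s) * (f + r *: 1) + (s * f - 1) + r *: s
       = k *: (f + r *: 1) - 1 by alg_ring.
    by rewrite scalerBr scalerA mulVf ?lt0r_neq0 // scale1r scalerBl addrA.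
  apply: (SZ); first by rewrite invr_ge0 ltW.
  by apply: (SD); [apply: (SD) => //; exact: SM | exact: SZ].
have ki0 : 0 < k^-1 by rewrite invr_gt0.
have down n r : r <= n%:R * k^-1 -> S (f + r *: 1) -> S f.
  elim: n r => [|n IH] r rn Sr.
    have -> : f = (f + r *: 1) + (- r) *: 1 by alg_ring.
    by apply: (SD) => //; apply: (SZ) => //; rewrite mul0r in rn; lra.
  have [r0|r0] := leP 0 r; last first.
    by apply: (IH r) => //; apply: le_trans (ltW r0) _; rewrite mulr_ge0 // ltW.
  apply: (IH (r - k^-1)); last exact: step.
  by move: rn; rewrite -natr1 mulrDl; lra.
have [l l0 [_]] := Sarch f; rewrite addrC.
apply: (down (Num.bound (l * k))).
rewrite ler_pdivlMr //; apply/ltW.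
by have := archi_boundP (mulr_ge0 (ltW l0) (ltW k0)).
Qed.

(** Twice [l m + a b] is [(l - a) (m - b) + (l + a) (m + b)], and likewise for
    [l m - a b]. *)
Lemma dominatedM S a b : is_semiring S ->
  dominated S 1 a -> dominated S 1 b -> dominated S 1 (a * b).
Proof.
move=> [S1 SD SZ SM] [l l0 [la la']] [m m0 [mb mb']].
exists (l * m); first exact: mulr_gt0.
have half x : S (2 *: x) -> S x.
  move=> /(SZ 2^-1); rewrite scalerA mulVf ?pnatr_eq0 // scale1r.
  by apply; rewrite invr_ge0.
split; apply: half.
- have -> : 2 *: ((l * m) *: 1 - a * b) =
    (l *: 1 - a) * (m *: 1 + b) + (l *: 1 + a) * (m *: 1 - b) by alg_ring.
  by apply: (SD); exact: SM.
- have -> : 2 *: ((l * m) *: 1 + a * b) =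
    (l *: 1 - a) * (m *: 1 - b) + (l *: 1 + a) * (m *: 1 + b) by alg_ring.
  by apply: (SD); exact: SM.
Qed.

Lemma dominatedD S a b e : is_semiring S ->
  dominated S e a -> dominated S e b -> dominated S e (a + b).
Proof.
move=> [S1 SD SZ SM] [l l0 [la la']] [m m0 [mb mb']].
exists (l + m); first exact: addr_gt0.
split.
- have -> : (l + m) *: e - (a + b) = (l *: e - a) + (m *: e - b) by alg_ring.
  exact: SD.
- have -> : (l + m) *: e + (a + b) = (l *: e + a) + (m *: e + b) by alg_ring.
  exact: SD.
Qed.

Lemma dominated_scalar S r : is_semiring S -> dominated S 1 (r *: 1).
Proof.
move=> HS; exists (`|r| + 1); first by have := normr_ge0 r; lra.
rewrite -scalerBl -scalerDl; split; apply: semiring_scalar => //.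
- by have := ler_norm r; lra.
- by have := ler_norm (- r); rewrite normrN; lra.
Qed.

End Modules.

Arguments scalars {R A}.

(** * Polynomials *)

Section Polynomials.
Variables (R : realType) (d : nat).
Local Notation P := {mpoly R[d]}.
Local Notation "''x_' i" := (mpolyX R (mnm1 i)) (at level 8, i at level 2).

Lemma semiring_gen_semiring (A : comAlgType R) (G : set A) :
  is_semiring (semiring_gen G).
Proof.
split.
- by move=> X [[]].
- by move=> a b Sa Sb X XG; have [[_ XD _ _] _] := XG; apply: XD;
    [exact: Sa | exact: Sb].
- by move=> l a l0 Sa X XG; have [[_ _ XZ _] _] := XG; apply: XZ => //; exact: Sa.
- by move=> a b Sa Sb X XG; have [[_ _ _ XM] _] := XG; apply: XM;
    [exact: Sa | exact: Sb].
Qed.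

Lemma nonneg_semiring (t : 'rV[R]_d) : is_semiring [set p | 0 <= mpoly_at p t].
Proof.
rewrite /mpoly_at; split => /=.
- by rewrite meval1 ler01.
- by move=> a b a0 b0; rewrite mevalD addr_ge0.
- by move=> l a l0 a0; rewrite mevalZ mulr_ge0.
- by move=> a b a0 b0; rewrite mevalM mulr_ge0.
Qed.

Lemma mpoly_ind_ring (Q : P -> Prop) : Q 1 -> (forall i, Q 'x_i) ->
  (forall p q, Q p -> Q q -> Q (p + q)) -> (forall c p, Q p -> Q (c *: p)) ->
  (forall p q, Q p -> Q q -> Q (p * q)) -> forall p, Q p.
Proof.
move=> Q1 QX QD QZ QM p; rewrite [p]mpolyE.
apply: big_ind => //; first by rewrite -(scale0r (1 : P)); exact: QZ.
move=> m _; apply: QZ; rewrite mpolyXE_id; apply: big_ind => // i _.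
by elim: (m i) => [|k IH]; rewrite ?expr0 // exprS; exact: QM.
Qed.

Lemma mpoly_ind_affine (Q : P -> Prop) : Q 1 -> (forall i, Q 'x_i) ->
  (forall p q, Q p -> Q q -> Q (p + q)) -> (forall c p, Q p -> Q (c *: p)) ->
  forall p, affine_functionals p -> Q p.
Proof.
move=> Q1 QX QD QZ p p2; rewrite [p]mpolyE big_seq.
apply: big_ind => //; first by rewrite -(scale0r (1 : P)); exact: QZ.
move=> m /(mmeasure_mnm_lt mdeg) mp; apply: QZ.
have : (mdeg m < 2)%N by exact: leq_trans mp p2.
rewrite ltnS leq_eqVlt ltnS leqn0 mdeg_eq0.
move=> /orP[/mdeg1P[i /eqP ->]|/eqP ->]; first exact: QX.
by rewrite mpolyX0.
Qed.

Lemma archimedean_of_coordinates (S : set P) : is_semiring S ->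
  (forall i, dominated S 1 'x_i) -> archimedean S.
Proof.
move=> HS SX; apply: mpoly_ind_ring.
- by have := dominated_scalar 1 HS; rewrite scale1r.
- exact: SX.
- by move=> p q; exact: dominatedD.
- move=> c p Sp; rewrite -[p]mul1r scalerAl; apply: dominatedM => //.
  exact: dominated_scalar.
- by move=> p q; exact: dominatedM.
Qed.

(** The entries of [w] are the standard parts of the coordinates. As 1 is
    infinitesimal, the standard part of an affine [h] is that of its linear
    part, so it is the slope of [h] along [w]. *)
Lemma recession_direction (M : set P) e :
  module_over scalars M -> M e -> ~ M (- e) -> infinitesimal M e 1 ->
  (forall i, exists r, infinitesimal M e ('x_i - r *: e)) ->
  exists w : 'rV[R]_d,
    (forall i, infinitesimal M e ('x_i - w ord0 i *: e)) /\
    (forall h (t : 'rV[R]_d) c, affine_functionals h -> M h -> 0 <= c ->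
      mpoly_at h t <= mpoly_at h (t + c *: w)).
Proof.
move=> HM Me Ne I1 /choice[v Hv]; exists (\row_i v i).
have Hsc := @scalars_semiring R P.
split=> [i|h t c haff Mh c0]; first by rewrite mxE.
suff [r Ir rh] : exists2 r, infinitesimal M e (h - r *: e)
    & mpoly_at h (t + c *: \row_i v i) = mpoly_at h t + c * r.
  by rewrite rh lerDl mulr_ge0 //; exact: (standard_part_ge0 Hsc HM Ne Ir).
move: h haff {Mh}; apply: mpoly_ind_affine.
- exists 0; first by rewrite scale0r subr0.
  by rewrite /mpoly_at !meval1 mulr0 addr0.
- by move=> i; exists (v i) => //; rewrite /mpoly_at !mevalXU !mxE.
- move=> p q [r Ir Er] [s Is Es]; exists (r + s).
    have -> : p + q - (r + s) *: e = (p - r *: e) + (q - s *: e) by alg_ring.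
    exact: (infinitesimalD HM).
  by move: Er Es; rewrite /mpoly_at !mevalD => -> ->; ring.
- move=> a p [r Ir Er]; exists (a * r).
    have -> : a *: p - (a * r) *: e = a *: (p - r *: e) by alg_ring.
    exact: (infinitesimalZ Hsc HM).
  by move: Er; rewrite /mpoly_at !mevalZ => ->; ring.
Qed.

(** The standard part relative to 1 is a morphism of algebras, so it is
    evaluation at the point of the standard parts of the coordinates. *)
Lemma mpoly_at_standard_part (S M : set P) : is_semiring S -> archimedean S ->
  module_over S M -> S `<=` M -> total M -> ~ M (- 1) ->
  exists t : 'rV[R]_d, forall p, infinitesimal M 1 (p - mpoly_at p t *: 1).
Proof.
move=> HS Sarch HM SM Mtot M1.
have MM1 : M 1 by case: HM.
have inf0 : infinitesimal M 1 0.
  by move=> c c0; rewrite subr0 addr0; split; apply: (moduleZ HS HM) => //; exact: ltW.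
have [v Hv] : {v | forall i : 'I_d, infinitesimal M 1 ('x_i - v i *: 1)}.
  have /choice[v Hv] : forall i : 'I_d, exists r, infinitesimal M 1 ('x_i - r *: 1).
    move=> i; apply: (standard_part_exists HS HM) => //.
    exact: dominated_subset (Sarch _).
  by exists v.
exists (\row_i v i); apply: mpoly_ind_ring.
- by rewrite /mpoly_at meval1 scale1r subrr.
- by move=> i; rewrite /mpoly_at mevalXU mxE.
- move=> p q Ip Iq; rewrite /mpoly_at mevalD scalerDl opprD addrACA.
  exact: (infinitesimalD HM).
- move=> c p Ip; rewrite /mpoly_at mevalZ -scalerA -scalerBr.
  exact: (infinitesimalZ HS HM).
- rewrite /mpoly_at => p q Ip Iq; rewrite mevalM.
  set r := meval _ p in Ip *; set s := meval _ q in Iq *.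
  have -> : p * q - (r * s) *: 1 = q * (p - r *: 1) + r *: (q - s *: 1).
    by alg_ring.
  apply: (infinitesimalD HM); last exact: (infinitesimalZ HS HM).
  exact: (infinitesimalM HS HM).
Qed.

(** The points [t] where [S] is nonnegative are the characters of the algebra
    that are nonnegative on [S]. *)
Lemma archimedean_positivstellensatz (S : set P) f : is_semiring S -> archimedean S ->
  (forall t : 'rV[R]_d, (forall p, S p -> 0 <= mpoly_at p t) ->
    0 < mpoly_at f t) ->
  S f.
Proof.
move=> HS Sarch fpos; have [S1 SD SZ SM] := HS.
suff [s [s' [Ss Ss' E]]] : exists s s', [/\ S s, S s' & s * f = 1 + s'].
  exact: (archimedean_descent HS Sarch Ss Ss').
apply: contrapT => nex.
have S0 : S 0 by rewrite -(scale0r 1); exact: SZ.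
pose N := [set a | exists s s', [/\ S s, S s' & a = s' - s * f]].
have HN : module_over S N.
  split; first by exists 0, 1; rewrite mul0r subr0.
  - move=> _ _ [s [s' [Ss Ss' ->]]] [u [u' [Su Su' ->]]].
    by exists (s + u), (s' + u'); split; [exact: SD|exact: SD|ring].
  - move=> v _ Sv [s [s' [Ss Ss' ->]]].
    by exists (v * s), (v * s'); split; [exact: SM|exact: SM|ring].
have N1 : ~ N (- 1).
  move=> [s [s' [Ss Ss' E]]]; apply: nex; exists s, s'; split => //.
  by rewrite -[1]opprK E; ring.
have [M [HM NM M1 Mmax]] := maximal_module HS HN N1.
have SsubM : S `<=` M.
  by move=> s Ss; apply: NM; exists 0, s; rewrite mul0r subr0.
have Mtot := archimedean_module_total HS Sarch HM SsubM M1 Mmax.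
have [t Ht] := mpoly_at_standard_part HS Sarch HM SsubM Mtot M1.
have pos p : M p -> 0 <= mpoly_at p t.
  exact: (standard_part_ge0 HS HM M1 (Ht p)).
have : 0 < mpoly_at f t by apply: fpos => p /SsubM; exact: pos.
suff : 0 <= mpoly_at (- f) t by rewrite /mpoly_at mevalN; lra.
by apply/pos/NM; exists 1, 0; split => //; rewrite mul1r sub0r.
Qed.

Lemma compact_coordinate_bounded (C : set 'rV[R]_d) i : compact C ->
  exists B, forall t : 'rV[R]_d, C t -> `|t ord0 i| <= B.
Proof.
move=> Cc.
have /compact_bounded[B [_ HB]] : compact [set t ord0 i | t in C].
  apply: continuous_compact => //; apply: continuous_subspaceT => t.
  exact: coord_continuous.
exists (B + 1) => t Ct; apply: (HB (B + 1)); first by rewrite ltrDl.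
by exists t.
Qed.

(** Otherwise [C] would contain a ray: some direction [w] is a recession
    direction of every [h] in [H], and [w] is nonzero because some coordinate
    is [e] up to sign, whose standard part is 1 or -1. *)
Lemma archimedean_semiring_gen (C : set 'rV[R]_d) (H : set P) :
  C !=set0 -> compact C -> H `<=` @affine_functionals R d ->
  C = [set t | forall h, H h -> 0 <= mpoly_at h t] ->
  archimedean (semiring_gen H).
Proof.
move=> [t0 Ct0] Cc Haff CE.
have HS := semiring_gen_semiring H; have [S1 SD SZ SM] := HS.
set S := semiring_gen H in HS S1 SD SZ SM *.
have HsubS : H `<=` S by exact: sub_gen_smallest.
have Snn t : C t -> S `<=` [set p | 0 <= mpoly_at p t].
  by move=> Ct; apply: smallest_sub; [exact: nonneg_semiring | rewrite CE in Ct].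
have NS1 : ~ S (- 1).
  by move=> /(Snn _ Ct0) /=; rewrite /mpoly_at mevalN meval1; lra.
apply: archimedean_of_coordinates => //.
pose xs := [seq 'x_i | i <- enum 'I_d].
have xsE i : 'x_i \in xs by apply: map_f; rewrite mem_enum.
suff up b : (exists2 x, x \in xs & b = x \/ b = - x) -> exists l, S (l *: 1 - b).
  move=> i.
  have [l Sl] : exists l, S (l *: 1 - 'x_i) by apply: up; exists 'x_i; [|left].
  have [m Sm] : exists m, S (m *: 1 - - 'x_i) by apply: up; exists 'x_i; [|right].
  have l0 := normr_ge0 l; have m0 := normr_ge0 m.
  have := ler_norm l; have := ler_norm m => lm ll.
  exists (`|l| + `|m| + 1); first by lra.
  split.
  - have -> : (`|l| + `|m| + 1) *: 1 - 'x_i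
        = (l *: 1 - 'x_i) + (`|l| + `|m| + 1 - l) *: 1 by alg_ring.
    by apply: (SD) => //; apply: semiring_scalar => //; lra.
  - have -> : (`|l| + `|m| + 1) *: 1 + 'x_i
        = (m *: 1 - - 'x_i) + (`|l| + `|m| + 1 - m) *: 1 by alg_ring.
    by apply: (SD) => //; apply: semiring_scalar => //; lra.
move=> bx; apply: contrapT => /forallNP Nb.
have [M [e [[HM SsubM] [Me Ne] I1 [x xxs ex] dom]]] :=
  supporting_functional HS NS1 Nb bx.
have [w [Hw wh]] := recession_direction HM Me Ne I1 (fun i => dom _ (xsE i)).
have Hsc := @scalars_semiring R P.
have Cray c : 0 <= c -> C (t0 + c *: w).
  move=> c0; rewrite CE => h Hh.
  apply: le_trans (wh h t0 c (Haff _ Hh) (SsubM _ (HsubS _ Hh)) c0).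
  exact: (Snn _ Ct0 _ (HsubS _ Hh)).
have /mapP[j _ xj] := xxs.
have wj : w ord0 j != 0.
  apply/eqP => wj0; have := Hw j; rewrite wj0 scale0r subr0 -xj => Ix.
  have Ie : infinitesimal M e (1 *: e).
    by rewrite scale1r; case: ex => {2}->//; exact: infinitesimalN.
  by have /eqP := infinitesimal_unit Hsc HM Ne Ie; rewrite oner_eq0.
have [B HB] := compact_coordinate_bounded j Cc.
have wn : 0 < `|w ord0 j| by rewrite normr_gt0.
have B0 : 0 <= B by apply: le_trans (HB _ Ct0).
(* At this time the ray has moved by [2 B + 1] in coordinate [j], although two
   points of [C] differ there by at most [2 B]. *)
have c0 : 0 <= (2 * B + 1) / `|w ord0 j| by apply: divr_ge0 => //; lra.
have := HB _ (Cray _ c0); have := HB _ Ct0; rewrite !mxE.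
set c := _ / _ => Bt Btc.
have : `|c * w ord0 j| <= B + B.
  have -> : c * w ord0 j = (t0 ord0 j + c * w ord0 j) - t0 ord0 j by ring.
  by apply: le_trans (ler_normB _ _) _; exact: lerD.
by rewrite normrM (ger0_norm c0) divfK ?gt_eqF //; lra.
Qed.

End Polynomials.

Theorem theorem5p4 (R : realType) (d : nat) (C : set 'rV[R]_d)
    (H : set {mpoly R[d]})
    (C_neq0 : C !=set0) (C_compact : compact C) (C_convex : convex_set C)
    (H_supp : forall h, H h -> exists2 t0, C t0 & supporting_at C t0 h)
    (C_def : C = [set t | forall h, H h -> 0 <= mpoly_at h t]) :
  archimedean (semiring_gen H) /\
  (forall f : {mpoly R[d]},
     (forall t, C t -> 0 < mpoly_at f t) -> semiring_gen H f).
Proof.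
have Haff : H `<=` @affine_functionals R d by move=> h /H_supp[t0 _ []].
have Sarch := archimedean_semiring_gen C_neq0 C_compact Haff C_def.
split=> // f fpos; apply: archimedean_positivstellensatz => //.
  exact: semiring_gen_semiring.
move=> t St; apply: fpos; rewrite C_def => h Hh.
by apply: St; exact: sub_gen_smallest.
Qed.
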